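(* For a positive integer $n$, let $\mathfrak{S}_n$ be the set of permutations $\pi=(\pi(1),\ldots,\pi(n))$ of $\{1,\ldots,n\}$ and define $$V_n=\left\{\sum_{k=1}^{n-1} \frac{1}{\pi(k)-\pi(k+1)} : \pi\in\mathfrak{S}_n\right\}\subseteq \mathbb{Q}.$$ Then $V_3 \cap \mathbb{N} = \{2\}$, $V_5 \cap \mathbb{N} = \{1,2,4\}$, and for every positive integer $n\neq 3,5$, $$V_n \cap \mathbb{N} = \{ j\in\mathbb{Z} : 0\leq j\leq n-1,\ j\neq n-2\}.$$
   Context: Here $\mathbb{N}=\{0,1,2,\ldots\}$ denotes the set of nonnegative integers. For $n=1$ the sum is empty and equals $0$. *)

(* Defs.v *)
From mathcomp Require Import all_boot all_order all_fingroup all_algebra.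
From mathcomp Require Import boolp classical_sets.

Set Implicit Arguments.
Unset Strict Implicit.
Unset Printing Implicit Defensive.

Import GRing.Theory.
Local Open Scope classical_set_scope.
Local Open Scope ring_scope.

(* The word (pi(1), ..., pi(n)) of a permutation of {1, ..., n}. Elements of
   'S_n permute {0, ..., n-1}, hence the successor on values; the entry
   pi(k) is (one_line pi)`_k.-1. *)
Definition one_line (n : nat) (pi : 'S_n) : seq rat :=
  [seq (pi i).+1%:R | i <- enum 'I_n].

Definition recip_diff_sum (n : nat) (pi : 'S_n) : rat :=
  \sum_(1 <= k < n) 1 / ((one_line pi)`_k.-1 - (one_line pi)`_k).

Definition V (n : nat) : set rat := [set recip_diff_sum pi | pi in [set: 'S_n]].

Definition natQ : set rat := [set m%:R | m in [set: nat]].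

(* Main.v *)
Require Import Defs.
From mathcomp Require Import all_boot all_order all_fingroup all_algebra.
From mathcomp Require Import boolp classical_sets.
From mathcomp Require Import zify ring lra.

(** An ascent contributes a negative term and every other term is at most 1, so
    a permutation with an ascent has sum below n-2, while the only permutation
    without ascents has sum n-1.

    Conversely, consider words starting with their largest letter n.  Prepending
    n+1 raises the sum by 1, and prepending n+3, n+1, n+2 preserves it because
    1/2 - 1 + 1/2 = 0.  The words 4231, 635241, 82317645 with sum 0 thus give
    sum 0 for every n other than 1, 2, 3, 5, and prepending descents to these
    gives every sum j with n-j not in {1, 2, 3, 5}; the words 1, 4213 and 624315,
    with sums 0, 1 and 1, account for j = n-1, n-3 and n-5. *)

Set Implicit Arguments.
Unset Strict Implicit.
Unset Printing Implicit Defensive.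

Import Order.TTheory GRing.Theory Num.Theory.
Local Open Scope classical_set_scope.
Local Open Scope ring_scope.

Fixpoint word_sum (s : seq nat) : rat :=
  if s is x :: s' then
    if s' is y :: _ then 1 / (x%:R - y%:R) + word_sum s' else 0
  else 0.

Arguments word_sum : simpl never.

Lemma word_sum_cons2 x y s :
  word_sum [:: x, y & s] = 1 / (x%:R - y%:R) + word_sum (y :: s).
Proof. by []. Qed.

Lemma word_sumE (s : seq nat) (t := [seq x%:R | x <- s] : seq rat) :
  word_sum s = \sum_(1 <= k < size s) 1 / (t`_k.-1 - t`_k).
Proof.
rewrite {}/t; elim: s => [|x [|y s] IHs]; try by rewrite big_geq.
rewrite word_sum_cons2 IHs /= [RHS]big_ltn //=; congr (_ + _).
by rewrite [RHS]big_add1 /= !big_nat; apply: eq_bigr => -[].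
Qed.

(** Lists of letters, unlike elements of ['S_n], can be extended by prepending and enumerated by
    computation. *)
Lemma VP n x :
  V n x <-> exists2 s, perm_eq s (iota 1 n) & word_sum s = x.
Proof.
pose w (p : 'S_n) := [seq (p i).+1 | i <- enum 'I_n].
have wE p : recip_diff_sum p = word_sum (w p).
  rewrite word_sumE /recip_diff_sum /one_line /w size_map size_enum_ord.
  by rewrite -map_comp.
have wP s : perm_eq s (iota 1 n) <-> exists p, s = w p.
  (* With the identity word as a tuple, [tuple_permP] turns a rearrangement into a permutation. *)
  have -> : iota 1 n = [tuple (val i).+1 | i < n].
    by rewrite /= (map_comp S val) val_enum_ord -[1%N]addn0 iotaDl.
  split=> [/tuple_permP[p ->]|[p ->]]; last apply/tuple_permP; exists p;
    by apply: eq_map => i; rewrite tnth_mktuple.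
split=> [[p _ <-]|[s /wP[p ->] <-]]; last by exists p; rewrite ?wE.
by exists (w p); [apply/wP; exists p | rewrite wE].
Qed.

Lemma word_sum_le x s : uniq (x :: s) ->
  word_sum (x :: s) <= (size s)%:R /\
  (~~ path gtn x s -> word_sum (x :: s) < (size s)%:R - 1).
Proof.
elim: s x => [//|y s IHs] x.
move=> /[dup] /andP[xNs _] /andP[_ /IHs[le1 lt1]].
have nxy : x != y by move: xNs; rewrite inE negb_or => /andP[].
rewrite word_sum_cons2 /= -natr1 negb_and.
case: (ltnP y x) => [lt_yx|le_xy] /=.
  have le_inv : 1 / (x%:R - y%:R) <= 1 :> rat.
    have le_d : 1 <= x%:R - y%:R :> rat by rewrite lerBrDr nat1r ler_nat.
    by rewrite ler_pdivrMr; lra.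
  (* Since [y < x], any ascent lies in the tail, where the strict bound applies. *)
  by split=> [|/lt1 lt_sum]; lra.
(* With an ascent in front, the weak bound on the tail suffices. *)
have lt_inv : 1 / (x%:R - y%:R) < 0 :> rat.
  have lt_d : x%:R - y%:R < 0 :> rat by rewrite subr_lt0 ltr_nat; lia.
  by rewrite div1r invr_lt0.
by split=> [|_]; lra.
Qed.

Lemma rev_iota1S n : rev (iota 1 n.+1) = n.+1 :: rev (iota 1 n).
Proof. by rewrite -[X in iota 1 X]addn1 iotaD rev_cat add1n. Qed.

Lemma word_sum_rev_iota n : word_sum (rev (iota 1 n.+1)) = n%:R.
Proof.
elim: n => [//|n IHn]; rewrite !rev_iota1S word_sum_cons2 -rev_iota1S IHn.
by rewrite -natrB // subSnn divr1 nat1r.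
Qed.

Lemma V_nat_bound n m : V n.+1 m%:R -> (m <= n)%N /\ m.+1 <> n.
Proof.
case/VP=> s sP; case: (boolP (sorted gtn s)) => [s_sorted | sN].
  (* A strictly decreasing word is determined by its set of letters. *)
  have -> : s = rev (iota 1 n.+1).
    apply: (@irr_sorted_eq _ gtn) => //.
    - exact: rev_trans ltn_trans.
    - by move=> x /=; rewrite ltnn.
    - by rewrite rev_sorted iota_ltn_sorted.
    by move=> x; rewrite mem_rev (perm_mem sP).
  rewrite word_sum_rev_iota => /eqP; rewrite eqr_nat => /eqP; lia.
have := perm_uniq sP; have := perm_size sP; rewrite iota_uniq size_iota.
case: s sN {sP} => [//|x s] /= sN [sz] /word_sum_le[_ /(_ sN)] /[swap] ->.
by rewrite sz ltrBrDr natr1 ltr_nat; lia.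
Qed.

(** Fixing the first letter as [n] determines the differences created by prepending larger
    letters. *)
Definition top_word_sum n x :=
  exists2 s, perm_eq (n :: s) (iota 1 n) & word_sum (n :: s) = x.

Lemma top_word_sum_V n x : top_word_sum n x -> V n x.
Proof. by case=> s sP sx; apply/VP; exists (n :: s). Qed.

Lemma top_word_sum1 n x : top_word_sum n x -> top_word_sum n.+1 (x + 1).
Proof.
case=> s sP sx; exists (n :: s).
  by rewrite -[X in iota 1 X]addn1 iotaD perm_sym perm_catC add1n perm_cons
             perm_sym.
by rewrite word_sum_cons2 sx -natrB // subSnn divr1 addrC.
Qed.

Lemma top_word_sum3 n x : top_word_sum n x -> top_word_sum n.+3 x.
Proof.
case=> s sP sx; exists [:: n.+1, n.+2, n & s].
  rewrite -[X in iota 1 X]addn3 iotaD perm_sym perm_catC add1n /=.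
  rewrite (perm_catCA [:: n.+1; n.+2] [:: n.+3]) /= !perm_cons perm_sym.
  exact: sP.
rewrite !word_sum_cons2 sx -!natr1.
by field; lra.
Qed.

Lemma top_word_sumD n x k :
  top_word_sum n x -> top_word_sum (n + k)%N (x + k%:R).
Proof.
move=> nx; elim: k => [|k IHk]; first by rewrite addn0 addr0.
by rewrite addnS -natr1 addrA; apply: top_word_sum1.
Qed.

Lemma top_word_sum_0_ge4 n : (3 < n)%N -> n <> 5%N -> top_word_sum n 0.
Proof.
elim/ltn_ind: n => n IHn n_gt3 n_neq5.
(* Steps of 3 need the bases 4 and 6, and also 8, because 8 - 3 = 5 is excluded. *)
have [->|n_neq4] := eqVneq n 4; first by exists [:: 2; 3; 1]%N.
have [->|n_neq6] := eqVneq n 6; first by exists [:: 3; 5; 2; 4; 1]%N.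
have [->|n_neq8] := eqVneq n 8; first by exists [:: 2; 3; 1; 7; 6; 4; 5]%N.
by rewrite -(@subnK 3 n) ?addn3; [apply/top_word_sum3/IHn|]; lia.
Qed.

Lemma V_nat_attained n m : (m < n)%N -> m.+2 <> n ->
  (m = 0 -> n <> 3 /\ n <> 5)%N -> V n m%:R.
Proof.
move=> lt_mn neq2 m0; apply: top_word_sum_V.
have shift k d : (d + k)%N = n -> (k <= m)%N ->
    top_word_sum d (m - k)%:R -> top_word_sum n m%:R.
  by move=> <- le_km /(@top_word_sumD _ _ k); rewrite -natrD subnK.
have [d1|d_neq1] := eqVneq n m.+1.
  by apply: (shift m 1%N) => //; rewrite subnn; exists [::].
(* Here and for [m.+1.+4], [m0] gives [m > 0], so a base word of sum 1 leaves [m - 1] descents to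
   prepend. *)
have [d3|d_neq3] := eqVneq n m.+3.
  apply: (shift m.-1 4%N); [lia..|].
  by rewrite (_ : m - m.-1 = 1)%N; [exists [:: 2; 1; 3]%N | lia].
have [d5|d_neq5] := eqVneq n m.+1.+4.
  apply: (shift m.-1 6%N); [lia..|].
  by rewrite (_ : m - m.-1 = 1)%N; [exists [:: 2; 4; 3; 1; 5]%N | lia].
apply: (shift m (n - m)%N); [lia..|rewrite subnn].
by apply: top_word_sum_0_ge4; lia.
Qed.

(** [V_nat_bound] does not exclude 0 for lengths 3 and 5, so all rearrangements are checked by
    computation. *)
Lemma V3_neq0 : ~ V 3 0.
Proof.
case/VP=> s; rewrite -mem_permutations => sP /eqP; apply/negP.
by apply: (allP (a := fun s => word_sum s != 0)) sP; vm_compute.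
Qed.

Lemma V5_neq0 : ~ V 5 0.
Proof.
case/VP=> s; rewrite -mem_permutations => sP /eqP; apply/negP.
by apply: (allP (a := fun s => word_sum s != 0)) sP; vm_compute.
Qed.

(** Writing [m.+2 <> n] avoids truncated subtraction, which would wrongly exclude [m = 0] when
    [n = 1]. *)
Lemma V_natP n m : (0 < n)%N ->
  V n m%:R <-> [/\ (m < n)%N, m.+2 <> n & (m = 0 -> n <> 3 /\ n <> 5)%N].
Proof.
case: n => // n _; split=> [Vnm | []]; last exact: V_nat_attained.
have [le_mn neq] := V_nat_bound Vnm; split=> [//|[]//|m0].
by split=> n_eq; move: Vnm; rewrite m0 n_eq; [exact: V3_neq0|exact: V5_neq0].
Qed.

Theorem theorem2 :
  [/\ V 3 `&` natQ = [set 2%:R],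
      V 5 `&` natQ = [set 1%:R; 2%:R; 4%:R]
    & forall n : nat, (0 < n)%N -> n <> 3%N -> n <> 5%N ->
        V n `&` natQ =
        [set j%:~R | j in [set j : int | [/\ 0 <= j, j <= n%:Z - 1
                                           & j <> n%:Z - 2]]]].
Proof.
split=> [||n n_gt0 n_neq3 n_neq5]; apply/seteqP; split=> x /=.
- case=> /[swap] -[m _ <-] /V_natP[//|m_lt3 m_neq1 m_neq0].
  by congr _%:R; lia.
- by move=> ->; split; [apply/V_natP | exists 2%N].
- case=> /[swap] -[m _ <-] /V_natP[//|m_lt5 m_neq3 m_neq0].
  have [->|m_neq1] := eqVneq m 1%N; first by left; left.
  have [->|m_neq2] := eqVneq m 2%N; first by left; right.
  by right; congr _%:R; lia.
- by move=> [[]|] ->; (split; [apply/V_natP | eexists]).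
- case=> /[swap] -[m _ <-] /V_natP[//|m_ltn m_neq _].
  by exists m%:Z => //; split; lia.
case=> j [j_ge0 j_le j_neq] <-; case: j j_ge0 j_le j_neq => // m _ m_le m_neq.
by split; [apply/V_natP => //; split; lia | exists m].
Qed.
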